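(* Let $p\geq 2$ and let $V_1,\dots,V_p$ be pairwise disjoint finite sets. For each $i=1,\dots,p$ let $\mathcal{H}_i\subseteq 2^{V_i}$ be a hypergraph on $V_i$ which either is JM+ or is of the form $\mathcal{H}_i=\{\{a_i\},\{b_i\}\}$ with $V_i=\{a_i,b_i\}$, $a_i\neq b_i$ (a copy of $\binom{[2]}{1}$). Then the conjunctive compound $\mathcal{H}_1\otimes\dots\otimes\mathcal{H}_p$ is a JM+ hypergraph on $V_1\cup\dots\cup V_p$.
   Context: A hypergraph on a finite set $V$ is a family $\mathcal{H}\subseteq 2^V$ of nonempty subsets (edges) with $\bigcup_{H\in\mathcal{H}}H=V$. Positions are vectors $\mathbf{x}\in\mathbb{Z}_{+}^V$ ($\mathbb{Z}_+$ = nonnegative integers). In the game Nim$_\mathcal{H}$, a move $\mathbf{x}\to\mathbf{x}'$ (an $H$-move) consists of choosing an edge $H\in\mathcal{H}$ and passing to a position $\mathbf{x}'$ with $x'_i<x_i$ for $i\in H$ and $x'_i=x_i$ for $i\notin H$. The height $h_\mathcal{H}(\mathbf{x})$ is the maximum number of consecutive moves that can be made starting from $\mathbf{x}$. Let $m(\mathbf{x})=\min_{i\in V}x_i$. Properties: (A) An edge $H\in\mathcal{H}$ is transversal if $H\cap H'\neq\emptyset$ for all $H'\in\mathcal{H}$; $\mathcal{H}$ is transversal-free if it has no transversal edge. For $S\subseteq V$, $\mathcal{H}_S=\{H\in\mathcal{H}\mid H\subseteq S\}$. $\mathcal{H}$ satisfies (A) (is minimal transversal-free) if it is transversal-free but for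 every proper subset $S\subsetneq V$ with $\mathcal{H}_S\neq\emptyset$, $\mathcal{H}_S$ has a transversal edge (an edge of $\mathcal{H}_S$ meeting all edges of $\mathcal{H}_S$). (B) $\mathcal{H}$ is minimum-decreasing if for every position $\mathbf{x}$ with $m(\mathbf{x})>0$ there is a move $\mathbf{x}\to\mathbf{x}'$ with $m(\mathbf{x}')<m(\mathbf{x})$, $h_\mathcal{H}(\mathbf{x}')=h_\mathcal{H}(\mathbf{x})-1$ and $x_i-x'_i\leq 1$ for all $i\in V$. (C) A sequence of edges $H_0,\dots,H_q$ is a chain if for all $i=0,\dots,q-1$: $H_{i+1}\cap H_i\neq\emptyset$, $|H_{i+1}\setminus H_i|=1$, and $H_i\subseteq H_0\cup H_q$; $\mathcal{H}$ has the chain property if for any two distinct edges $H,H'$ there is a chain with $H_0=H$, $H_q=H'$. $\mathcal{H}$ is JM+ if it satisfies (A), (B) and (C). For hypergraphs $\mathcal{H}_i\subseteq 2^{V_i}$ on pairwise disjoint sets, the conjunctive compound is $\mathcal{H}_1\otimes\dots\otimes\mathcal{H}_p=\{\bigcup_{i=1}^p H^i\mid H^i\in\mathcal{H}_i,\ i=1,\dots,p\}$. *)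

(* Defs.v *)
From mathcomp Require Import all_boot.

Set Implicit Arguments.
Unset Strict Implicit.
Unset Printing Implicit Defensive.

(* All vertex sets live in an ambient finite type T; a family of edges is a
   {set {set T}}, and its vertex set V : {set T} is passed explicitly. *)

Section Hypergraph.

Variable T : finType.

Implicit Types (V S E F : {set T}) (H : {set {set T}}) (x y : {ffun T -> nat}).

(* V != set0 is implicit in the literature: min_(i in V) x_i must exist. *)
Definition is_hypergraph V H : Prop :=
  [/\ V != set0, set0 \notin H & cover H = V].

(* Z_+^V, encoded as the functions on T that vanish outside V. *)
Definition is_position V x : Prop := forall i, i \notin V -> x i = 0.

Definition move H x y : bool :=
  [exists E in H, forall i, if i \in E then y i < x i else y i == x i].

(* n is the maximum number of consecutive moves from x; see height_exists and
   height_unique below. *)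
Definition is_height H x (n : nat) : Prop :=
  (exists2 s : seq {ffun T -> nat}, path (move H) x s & size s = n) /\
  (forall s : seq {ffun T -> nat}, path (move H) x s -> size s <= n).

(* The default value is at least every x i with i in V, so for V != set0 this
   is the genuine minimum; see min_pos_le and min_pos_attained below. *)
Definition min_pos V x : nat := \big[minn/(\max_(i in V) x i)]_(i in V) x i.

Definition transversal_edge H E : Prop :=
  E \in H /\ (forall F, F \in H -> E :&: F != set0).

Definition transversal_free H : Prop := ~ exists E, transversal_edge H E.

Definition induced H S : {set {set T}} := [set E in H | E \subset S].

Definition minimal_transversal_free V H : Prop :=
  transversal_free H /\
  (forall S, S \proper V -> induced H S != set0 ->
     exists E, transversal_edge (induced H S) E).

(* The height condition h(x') = h(x) - 1 reads h(x) = n.+1 and h(x') = n. *)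
Definition minimum_decreasing V H : Prop :=
  forall x, is_position V x -> 0 < min_pos V x ->
  exists x', [/\ move H x x',
    min_pos V x' < min_pos V x,
    exists2 n, is_height H x n.+1 & is_height H x' n
    & forall i, i \in V -> x i - x' i <= 1].

Definition chain_step E F : bool := (F :&: E != set0) && (#|F :\: E| == 1).

(* The sequence H_0, H_1, ..., H_q is E0 :: s; its last term is last E0 s. *)
Definition chain H E0 (s : seq {set T}) : bool :=
  [&& all (mem H) (E0 :: s), path chain_step E0 s
    & all (fun E => E \subset E0 :|: last E0 s) (E0 :: s)].

Definition chain_property H : Prop :=
  forall E F, E \in H -> F \in H -> E != F ->
  exists2 s, chain H E s & last E s = F.

Definition JM_plus V H : Prop :=
  [/\ minimal_transversal_free V H, minimum_decreasing V H & chain_property H].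

(* A copy of the hypergraph of all 1-subsets of a 2-set. *)
Definition two_singletons V H : Prop :=
  exists a b : T, [/\ a != b, V = [set a; b] & H = [set [set a]; [set b]]].

Definition conj_compound (p : nat) (H : 'I_p -> {set {set T}}) : {set {set T}} :=
  [set \bigcup_i f i | f : {ffun 'I_p -> {set T}} in family H].

Lemma move_sum H x y : set0 \notin H -> move H x y ->
  \sum_i y i < \sum_i x i.
Proof.
move=> H0 /existsP[E /andP[EH /forallP xy]].
have [i iE] : exists i, i \in E.
  by apply/set0Pn; apply: contraNneq H0 => <-.
have le_yx j : y j <= x j by have := xy j; case: ifP => _ => [/ltnW|/eqP->].
rewrite (bigD1 i) //= (bigD1 i (F := x)) //= -addSn leq_add ?leq_sum //.
by have := xy i; rewrite iE.
Qed.

Lemma play_bound H x s : set0 \notin H -> path (move H) x s ->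
  size s <= \sum_i x i.
Proof.
move=> H0; elim: s x => //= y s IHs x /andP[/(move_sum H0) lt_yx /IHs le_s].
exact: leq_ltn_trans le_s lt_yx.
Qed.

Lemma height_exists H x : set0 \notin H -> exists n, is_height H x n.
Proof.
move=> H0; have [N] := ubnP (\sum_i x i); elim: N x => // N IHN x lt_xN.
pose g (z : {ffun T -> 'I_N.+1}) : {ffun T -> nat} := [ffun i => nat_of_ord (z i)].
have /fin_all_exists[h hP] z :
    exists n, move H x (g z) -> is_height H (g z) n.
  case: (boolP (move H x (g z))) => [xz | _]; last by exists 0.
  have [|n hn] := IHN (g z); last by exists n.
  exact: leq_trans (move_sum H0 xz) lt_xN.
have gP y : move H x y -> exists z, y = g z.
  move=> xy; exists [ffun i => inord (y i)]; apply/ffunP=> i.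
  rewrite !ffunE inordK // ltnS.
  apply: leq_trans (_ : \sum_j y j <= N); first by rewrite (bigD1 i) ?leq_addr.
  exact: leq_trans (ltnW (move_sum H0 xy)) lt_xN.
exists (\max_(z | move H x (g z)) (h z).+1); split=> [|[|y s] //=].
  have [z0 xz0 | nox] := pickP (fun z => move H x (g z)); last first.
    by exists [::]; rewrite ?big_pred0.
  have [|z xz ->] := eq_bigmax_cond (A := [pred z | move H x (g z)]) (fun z => (h z).+1).
    by apply/card_gt0P; exists z0.
  have [[s zs <-] _] := hP z xz.
  by exists (g z :: s) => //=; rewrite zs andbT.
case/andP=> xy ys; have [z def_y] := gP y xy; rewrite {}def_y in xy ys.
apply: (bigmax_sup z) => //; rewrite ltnS.
by have [_] := hP z xy; apply.
Qed.

Lemma height_unique H x m n : is_height H x m -> is_height H x n -> m = n.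
Proof.
move=> [[s xs <-] max_m] [[t xt <-] max_n].
by apply/eqP; rewrite eqn_leq max_m // max_n.
Qed.

Lemma min_pos_le V x i : i \in V -> min_pos V x <= x i.
Proof.
rewrite /min_pos; move: (\max_(j in V) _) => d iV.
have := mem_index_enum i; elim: (index_enum T) => //= j s IHs.
rewrite big_cons inE => /predU1P[<-|/IHs le_i]; first by rewrite iV geq_minl.
by case: ifP => // _; apply: leq_trans le_i; apply: geq_minr.
Qed.

Lemma min_pos_attained V x : V != set0 ->
  exists2 i, i \in V & min_pos V x = x i.
Proof.
case/set0Pn=> i0 i0V; rewrite /min_pos.
apply: (big_ind (fun m => exists2 i, i \in V & m = x i)) => [|m n [i iV ->] [j jV ->]|i iV];
  last by exists i.
  have /(eq_bigmax_cond x)[i iV ->] : 0 < #|V| by apply/card_gt0P; exists i0.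
  by exists i.
by case: (leqP (x i) (x j)) => _; [exists i | exists j].
Qed.

End Hypergraph.

(* Main.v *)
(** A move of the compound is a simultaneous move in every component, so its
    height is the least height of a component; playing all the
    minimum-decreasing moves at once therefore lowers both the height and the
    minimum.  An edge of the compound is transversal exactly when one of its
    components is.  Chains are obtained by replacing the components of an edge
    one at a time; the components that stay put (here [2 <= p] matters) make
    consecutive edges intersect, so that inside a component only
    [#|H_(i+1) :\: H_i| = 1] and containment are needed.  This weaker form of
    the chain property also holds for two disjoint singletons. *)

Require Import Defs.
From mathcomp Require Import all_boot.

Set Implicit Arguments.
Unset Strict Implicit.
Unset Printing Implicit Defensive.

Lemma path_rel_in (T : Type) (A : {pred T}) (e : rel T) x s : x \in A ->
  path [rel y z in A | e y z] x s = all (mem A) s && path e x s.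
Proof.
elim: s x => //= y s IHs x xA; rewrite xA /=.
by case: (boolP (y \in A)) => //= yA; rewrite IHs // andbCA.
Qed.

Lemma subset_bigcup (I T : finType) (A B : I -> {set T}) :
  (forall i, A i \subset B i) -> \bigcup_i A i \subset \bigcup_i B i.
Proof. by move=> AB; apply/bigcupsP=> i _; apply: bigcup_max (AB i). Qed.

Lemma homo_connect (T T' : finType) (e : rel T) (e' : rel T') (f : T -> T') :
  {homo f : x y / e x y >-> connect e' x y} ->
  {homo f : x y / connect e x y >-> connect e' x y}.
Proof.
move=> homo_f x _ /connectP[s xs ->].
elim: s x xs => [|y s IHs] x /=; first by rewrite connect0.
by case/andP=> /homo_f xy /IHs; apply: connect_trans.
Qed.

Section Hypergraph.

Variable T : finType.
Implicit Types (V S E F : {set T}) (H : {set {set T}}) (x y : {ffun T -> nat}).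
Implicit Type e : rel {set T}.

Lemma edge_neq0 H E : set0 \notin H -> E \in H -> E != set0.
Proof. by move=> H0 EH; apply: contraNneq H0 => <-. Qed.

Lemma edge_exists V H : is_hypergraph V H -> exists E, E \in H.
Proof.
case=> /set0Pn[t tV] _ cover_H; move: tV.
by rewrite -cover_H => /bigcupP[E EH _]; exists E.
Qed.

Lemma mem_induced H S E : (E \in induced H S) = (E \in H) && (E \subset S).
Proof. by rewrite inE. Qed.

Lemma induced_sub H S : induced H S \subset H.
Proof. by apply/subsetP=> E; rewrite mem_induced => /andP[]. Qed.

Lemma cover_induced H S : cover (induced H S) \subset cover H.
Proof.
by apply/bigcupsP=> E EI; apply/bigcup_sup/(subsetP (induced_sub H S)).
Qed.

Lemma inducedIr V H S : cover H \subset V -> induced H (S :&: V) = induced H S.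
Proof.
move=> /bigcupsP sub_HV; apply/setP=> E; rewrite !mem_induced subsetI.
by case: (boolP (E \in H)) => //= /sub_HV->; rewrite andbT.
Qed.

(** * Positions *)

Definition restrict V x : {ffun T -> nat} :=
  [ffun t => if t \in V then x t else 0].

Lemma restrict_in V x : {in V, restrict V x =1 x}.
Proof. by move=> t tV; rewrite ffunE tV. Qed.

Lemma is_position_restrict V x : is_position V (restrict V x).
Proof. by move=> t /negPf tV; rewrite ffunE tV. Qed.

Lemma eq_min_pos V x y : {in V, x =1 y} -> min_pos V x = min_pos V y.
Proof.
move=> eq_xy; rewrite /min_pos (eq_bigr y eq_xy).
by congr (bigop _ _ _); apply: eq_bigr.
Qed.

Lemma min_pos_sub V S x :
  S != set0 -> S \subset V -> min_pos V x <= min_pos S x.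
Proof.
move=> /(min_pos_attained x)[t tS ->] /subsetP sub_SV.
by apply/min_pos_le/sub_SV.
Qed.

(** * Moves and plays *)

Definition edge_move E x y : bool :=
  [forall t, if t \in E then y t < x t else y t == x t].

Lemma moveP H x y : reflect (exists2 E, E \in H & edge_move E x y) (move H x y).
Proof. exact: exists_inP. Qed.

Lemma move_position V H x y : is_position V x -> move H x y -> is_position V y.
Proof.
move=> x_pos /moveP[E _ /forallP xy] t tV.
by have := xy t; rewrite x_pos //; case: ifP => // _ /eqP.
Qed.

Definition playable H x n :=
  exists2 s : seq {ffun T -> nat}, path (move H) x s & size s = n.

Lemma playable0 H x : playable H x 0.
Proof. by exists [::]. Qed.

Lemma playableS H x n :
  playable H x n.+1 <-> exists2 y, move H x y & playable H y n.
Proof.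
split=> [[[|y s] //= /andP[xy ys] [size_s]] | [y xy [s ys size_s]]].
  by exists y => //; exists s.
by exists (y :: s) => /=; rewrite ?xy ?size_s.
Qed.

Lemma playable_leq H x m n : m <= n -> playable H x n -> playable H x m.
Proof.
move=> le_mn [s xs size_s]; exists (take m s); first exact: take_path.
by rewrite size_takel ?size_s.
Qed.

Lemma is_heightP H x n :
  is_height H x n <-> (forall m, playable H x m <-> m <= n).
Proof.
split=> [[xn max_n] m | playableP].
  by split=> [[s xs <-] | le_mn]; [apply: max_n | apply: playable_leq xn].
by split=> [|s xs]; [apply/playableP | apply/playableP; exists s].
Qed.

Definition drops_height H x y : Prop :=
  exists2 n, is_height H x n.+1 & is_height H y n.

(** * Chains *)

Definition weak_chain_step E F : bool := #|F :\: E| == 1.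

Definition step_connected e H : Prop :=
  {in H &, forall E F,
    connect [rel E' F' in induced H (E :|: F) | e E' F'] E F}.

Lemma sub_step_connected e e' H :
  subrel e e' -> step_connected e H -> step_connected e' H.
Proof.
move=> sub_e e_conn E F EH FH; apply: connect_sub (e_conn E F EH FH).
by move=> E' F' /andP[in_EF /sub_e E'F']; apply/connect1/andP.
Qed.

Lemma chainE H E s :
  chain H E s = (E \in H) &&
    path [rel E' F' in induced H (E :|: last E s) | chain_step E' F'] E s.
Proof.
rewrite /chain /= subsetUl /=; case: (boolP (E \in H)) => //= EH.
rewrite path_rel_in ?mem_induced ?EH ?subsetUl // andbCA andbC -all_predI.
by congr (_ && _); apply: eq_all => F; rewrite /= mem_induced.
Qed.

Lemma chain_propertyP H : chain_property H <-> step_connected (@chain_step T) H.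
Proof.
split=> [chains E F EH FH | conn E F EH FH _].
  have [->|neq_EF] := eqVneq E F; first exact: connect0.
  have [s chain_s last_s] := chains E F EH FH neq_EF.
  by apply/connectP; exists s => //; move: chain_s; rewrite chainE EH last_s.
have /connectP[s path_s last_s] := conn E F EH FH.
by exists s => //; rewrite chainE EH -last_s.
Qed.

Definition weak_JM_plus V H : Prop :=
  [/\ minimal_transversal_free V H, minimum_decreasing V H
    & step_connected weak_chain_step H].

Lemma JM_plusW V H : JM_plus V H -> weak_JM_plus V H.
Proof.
case=> mtf_H md_H /chain_propertyP chain_H; split=> //.
by apply: sub_step_connected chain_H => E F /andP[].
Qed.

(** * Singletons *)

Definition singletons V : {set {set T}} := [set [set c] | c in V].

Lemma set0_notin_singletons V : set0 \notin singletons V.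
Proof. by apply/imsetP=> -[c _ /setP/(_ c)]; rewrite set11 inE. Qed.

Lemma transversal_free_singletons V :
  1 < #|V| -> transversal_free (singletons V).
Proof.
move=> V_gt1 [_ [/imsetP[c cV ->] c_transversal]].
have /card_gt0P[d /setD1P[dc dV]] : 0 < #|V :\ c|.
  by move: V_gt1; rewrite (cardsD1 c) cV.
have := c_transversal [set d] (imset_f _ dV).
by rewrite setI_eq0 disjoints1 inE eq_sym (negPf dc).
Qed.

Lemma minimal_transversal_free_singletons V :
  #|V| = 2 -> minimal_transversal_free V (singletons V).
Proof.
move=> V2; split=> [|S /proper_card].
  by apply: transversal_free_singletons; rewrite V2.
rewrite V2 ltnS => S_le1 /set0Pn[E EI]; exists E; split=> // F.
have /eqP S_E : E == S.
  move: EI; rewrite mem_induced => /andP[/imsetP[c _ ->]].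
  by rewrite eqEcard cards1 S_le1 andbT.
rewrite mem_induced S_E => /andP[FH /setIidPr->].
exact: edge_neq0 (set0_notin_singletons V) FH.
Qed.

Definition decr x c : {ffun T -> nat} := [ffun t => x t - (t == c)].

Lemma move_decr V x c : c \in V -> 0 < x c -> move (singletons V) x (decr x c).
Proof.
move=> cV xc_gt0; apply/moveP; exists [set c]; first exact: imset_f.
apply/forallP=> t; rewrite ffunE inE.
by case: eqVneq => [->|_]; rewrite ?subn0 // subn1 prednK.
Qed.

Lemma sum_decr x c : 0 < x c -> (\sum_t decr x c t).+1 = \sum_t x t.
Proof.
move=> xc_gt0; rewrite (bigD1 c) //= [RHS](bigD1 c) //= ffunE eqxx subn1.
rewrite -addSn prednK //; congr (_ + _); apply: eq_bigr => t /negPf tc.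
by rewrite ffunE tc subn0.
Qed.

Lemma playable_singletons V x :
  is_position V x -> playable (singletons V) x (\sum_t x t).
Proof.
move sum_x: (\sum_t x t) => n; elim: n x sum_x => [|n IHn] x sum_x x_pos.
  exact: playable0.
have [c xc_gt0] : exists c, 0 < x c.
  apply/existsP; apply: contraPT sum_x => /existsPn x0.
  by rewrite big1 // => c _; apply/eqP; rewrite eqn0Ngt.
have cV : c \in V by apply: contraLR xc_gt0 => /x_pos->.
have x_decr := move_decr cV xc_gt0.
apply/playableS; exists (decr x c) => //; apply: IHn.
  by apply: succn_inj; rewrite sum_decr.
exact: move_position x_decr.
Qed.

Lemma is_height_singletons V x :
  is_position V x -> is_height (singletons V) x (\sum_t x t).
Proof.
move=> x_pos; split=> [|s]; first exact: playable_singletons.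
by apply: play_bound; apply: set0_notin_singletons.
Qed.

Lemma minimum_decreasing_singletons V :
  V != set0 -> minimum_decreasing V (singletons V).
Proof.
move=> V_neq0 x x_pos x_gt0; have [c cV min_c] := min_pos_attained x V_neq0.
have xc_gt0 : 0 < x c by rewrite -min_c.
have x_decr := move_decr cV xc_gt0.
exists (decr x c); split=> // [||t _].
- apply: leq_ltn_trans (min_pos_le _ cV) _.
  by rewrite ffunE eqxx min_c subn1 prednK.
- exists (\sum_t decr x c t).
    by rewrite sum_decr //; apply: is_height_singletons.
  exact/is_height_singletons/(move_position x_pos x_decr).
by rewrite ffunE leq_subLR addnC -leq_subLR leq_sub2l // leq_b1.
Qed.

Lemma step_connected_singletons V :
  step_connected weak_chain_step (singletons V).
Proof.
move=> E F EH FH; have [->|] := eqVneq E F; first exact: connect0.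
move=> neq_EF; apply: connect1.
rewrite /= !mem_induced EH FH subsetUl subsetUr /=.
move: EH FH neq_EF => /imsetP[c _ ->] /imsetP[d _ ->].
rewrite eqEcard !cards1 andbT sub1set inE => cd.
by rewrite /weak_chain_step (setDidPl _) ?cards1 // disjoints1 inE eq_sym.
Qed.

Lemma two_singletonsE V H :
  two_singletons V H -> #|V| = 2 /\ H = singletons V.
Proof.
case=> a [b [neq_ab -> ->]]; rewrite cards2 neq_ab.
by rewrite /singletons imsetU !imset_set1.
Qed.

Lemma weak_JM_plus_two_singletons V H : two_singletons V H -> weak_JM_plus V H.
Proof.
case/two_singletonsE=> V2 ->; split.
- exact: minimal_transversal_free_singletons.
- by apply: minimum_decreasing_singletons; rewrite -card_gt0 V2.
exact: step_connected_singletons.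
Qed.

End Hypergraph.

Section Compound.

Variables (T : finType) (p : nat) (V : 'I_p -> {set T}).
Hypothesis disjV : forall i j : 'I_p, i != j -> [disjoint V i & V j].
Implicit Types (H : 'I_p -> {set {set T}}) (f g : 'I_p -> {set T}).
Implicit Types (S E F : {set T}) (x y : {ffun T -> nat}).
Implicit Type z : 'I_p -> {ffun T -> nat}.

Lemma compoundP H E :
  reflect (exists2 f, (forall i, f i \in H i) & E = \bigcup_i f i)
          (E \in conj_compound H).
Proof.
apply: (iffP imsetP) => [[f /familyP fH ->] | [f fH ->]]; first by exists f.
exists (finfun f); first by apply/familyP=> i; rewrite ffunE.
by apply: eq_bigr => i _; rewrite ffunE.
Qed.

Lemma mem_compound H f :
  (forall i, f i \in H i) -> \bigcup_i f i \in conj_compound H.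
Proof. by move=> fH; apply/compoundP; exists f. Qed.

Lemma induced_compound H S :
  induced (conj_compound H) S = conj_compound (fun i => induced (H i) S).
Proof.
apply/setP=> E; rewrite mem_induced; apply/andP/compoundP => [[] | [f fHS ->]].
  case/compoundP=> f fH -> /bigcupsP fS; exists f => // i.
  by rewrite mem_induced fH fS.
split.
  by apply: mem_compound => i; apply: (subsetP (induced_sub _ S) _ (fHS i)).
by apply/bigcupsP=> i _; have := fHS i; rewrite mem_induced => /andP[].
Qed.

Lemma compound_induced_sub H (A : 'I_p -> {set T}) :
  conj_compound (fun i => induced (H i) (A i)) \subset
    induced (conj_compound H) (\bigcup_i A i).
Proof.
apply/subsetP=> _ /compoundP[f fHA ->]; rewrite mem_induced.
have f_in i : f i \in H i /\ f i \subset A i.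
  by have := fHA i; rewrite mem_induced => /andP[].
rewrite mem_compound => [|i]; last by case: (f_in i).
by apply: subset_bigcup => i; case: (f_in i).
Qed.

Definition replace f i E : 'I_p -> {set T} :=
  dfwith (T := fun=> {set T}) f (i := i) E.

Lemma replace_id f i E : replace f i E i = E.
Proof. exact: dfwith_in. Qed.

Lemma replace_neq f i E j : i != j -> replace f i E j = f j.
Proof. exact: dfwith_out. Qed.

Lemma mem_replace H f i E :
  E \in H i -> (forall j, f j \in H j) -> forall j, replace f i E j \in H j.
Proof. by move=> EH fH j; rewrite /replace; case: dfwithP. Qed.

Section DisjointUnion.

Variable f : 'I_p -> {set T}.
Hypothesis fV : forall i, f i \subset V i.

Lemma mem_bigcup_disjoint i t :
  t \in V i -> (t \in \bigcup_j f j) = (t \in f i).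
Proof.
move=> tV; apply/bigcupP/idP => [[j _ tj] | ti]; last by exists i.
have [<- //|neq_ji] := eqVneq j i.
by rewrite (disjointFr (disjV neq_ji) (subsetP (fV j) t tj)) in tV.
Qed.

Lemma edge_move_bigcup x y :
  edge_move (\bigcup_i f i) x y <->
    (forall i, edge_move (f i) (restrict (V i) x) (restrict (V i) y)) /\
    {in ~: \bigcup_i V i, y =1 x}.
Proof.
split=> [/forallP xy | [xy eq_xy]].
  split=> [i | t].
    apply/forallP=> t; rewrite !ffunE; have [tV | tV] := boolP (t \in V i).
      by rewrite -(mem_bigcup_disjoint tV).
    by rewrite (contraNF (subsetP (fV i) t) tV).
  rewrite inE => tV; apply/eqP; have := xy t; rewrite ifN //.
  by apply: contra tV; apply/subsetP/subset_bigcup.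
apply/forallP=> t; have [/bigcupP[i _ tV] | tV] := boolP (t \in \bigcup_i V i).
  have /forallP/(_ t) := xy i.
  by rewrite !restrict_in // (mem_bigcup_disjoint tV).
rewrite ifN; first by rewrite eq_xy // inE.
by apply: contra tV; apply/subsetP/subset_bigcup.
Qed.

End DisjointUnion.

Definition glue x z : {ffun T -> nat} :=
  [ffun t => if [pick i | t \in V i] is Some i then z i t else x t].

Lemma restrict_glue x z i :
  is_position (V i) (z i) -> restrict (V i) (glue x z) = z i.
Proof.
move=> z_pos; apply/ffunP=> t; rewrite ffunE; case: ifPn => [tV | /z_pos-> //].
rewrite ffunE; case: pickP => [j tVj | /(_ i)]; last by rewrite tV.
have [-> //|neq_ji] := eqVneq j i.
by rewrite (disjointFr (disjV neq_ji) tVj) in tV.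
Qed.

Lemma glue_notin x z : {in ~: \bigcup_i V i, glue x z =1 x}.
Proof.
move=> t; rewrite inE ffunE; case: pickP => // i tV.
by case/bigcupP; exists i.
Qed.

Lemma min_pos_restrict_ltn x y : 0 < p -> (forall i, V i != set0) ->
  (forall i,
     min_pos (V i) (restrict (V i) y) < min_pos (V i) (restrict (V i) x)) ->
  min_pos (\bigcup_i V i) y < min_pos (\bigcup_i V i) x.
Proof.
move=> p_gt0 V_neq0 lt_yx.
have sub_V i : V i \subset \bigcup_j V j by apply: bigcup_sup.
have [|t /bigcupP[i _ tV] ->] := @min_pos_attained _ (\bigcup_i V i) x.
  by apply: subset_neq0 (sub_V (Ordinal p_gt0)) (V_neq0 _).
apply: leq_ltn_trans (min_pos_sub y (V_neq0 i) (sub_V i)) _.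
rewrite -(eq_min_pos (@restrict_in _ (V i) y)) -(restrict_in x tV).
exact: leq_trans (lt_yx i) (min_pos_le _ tV).
Qed.

Section DisjointCovers.

Variable H : 'I_p -> {set {set T}}.
Hypothesis cover_sub : forall i, cover (H i) \subset V i.

Let edge_sub f (fH : forall i, f i \in H i) i : f i \subset V i.
Proof. exact: subset_trans (bigcup_sup _ (fH i)) (cover_sub i). Qed.

(** * Transversal edges of the compound *)

Lemma transversal_compoundP f : (forall i, f i \in H i) ->
  transversal_edge (conj_compound H) (\bigcup_i f i) <->
  exists i, transversal_edge (H i) (f i).
Proof.
move=> fH; split=> [[_ f_transversal] | [i [_ fi_transversal]]].
  have [/existsP[i /forall_inP fi_meets]|] :=
    boolP [exists i, [forall E in H i, f i :&: E != set0]]; first by exists i.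
  move/existsPn=> not_transversal.
  have /fin_all_exists2[g gH fg] i : exists2 E, E \in H i & f i :&: E = set0.
    have /forall_inPn[E EH] := not_transversal i.
    by rewrite negbK => /eqP; exists E.
  have /set0Pn[t /setIP[/bigcupP[i _ tf]]] := f_transversal _ (mem_compound gH).
  have tV := subsetP (edge_sub fH i) t tf.
  rewrite (mem_bigcup_disjoint (edge_sub gH) tV) => tg.
  by have /setP/(_ t) := fg i; rewrite !inE tf tg.
split=> [|_ /compoundP[g gH ->]]; first exact: mem_compound.
have /set0Pn[t /setIP[tf tg]] := fi_transversal _ (gH i).
by apply/set0Pn; exists t; apply/setIP; split; apply/bigcupP; exists i.
Qed.

Lemma transversal_free_compound :
  (forall i, transversal_free (H i)) -> transversal_free (conj_compound H).
Proof.
move=> tf_H [E E_transversal]; have [/compoundP[f fH def_E] _] := E_transversal.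
rewrite def_E in E_transversal.
have /(transversal_compoundP fH)[i fi_transversal] := E_transversal.
by case: (tf_H i); exists (f i).
Qed.

(** * Chains of the compound *)

Lemma setD_bigcup_replace f i E F :
  (forall j, f j \in H j) -> E \in H i -> F \in H i ->
  (\bigcup_j replace f i F j) :\: (\bigcup_j replace f i E j) = F :\: E.
Proof.
move=> fH EH FH; have E_H := mem_replace EH fH; have F_H := mem_replace FH fH.
apply/setP=> t; rewrite !in_setD; have [tF | tF] := boolP (t \in F).
  have tV : t \in V i.
    by apply: (subsetP (cover_sub i)); apply/bigcupP; exists F.
  by rewrite !(mem_bigcup_disjoint (edge_sub _) tV) // !replace_id tF.
rewrite andbF; apply/negP => /andP[/bigcupP t_notin /bigcupP[j _ tj]].
apply: t_notin; exists j => //; have [eq_ij | neq_ij] := eqVneq i j.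
  by rewrite -eq_ij replace_id (negPf tF) in tj.
by move: tj; rewrite !replace_neq.
Qed.

Lemma chain_step_replace f i E F :
  1 < p -> (forall j, set0 \notin H j) -> (forall j, f j \in H j) ->
  E \in H i -> F \in H i -> weak_chain_step E F ->
  chain_step (\bigcup_j replace f i E j) (\bigcup_j replace f i F j).
Proof.
move=> p_gt1 H_neq0 fH EH FH EF; apply/andP; split; last first.
  by rewrite setD_bigcup_replace.
have /card_gt0P[j neq_ji] : 0 < #|predC1 i|.
  by rewrite cardC1 card_ord -subn1 subn_gt0.
have neq_ij : i != j by rewrite eq_sym.
have /set0Pn[t tf] := edge_neq0 (H_neq0 j) (fH j).
by apply/set0Pn; exists t; apply/setIP; split; apply/bigcupP; exists j;
  rewrite ?replace_neq.
Qed.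

Lemma connect_compound f g : 1 < p -> (forall i, set0 \notin H i) ->
  (forall i, f i \in H i) -> (forall i, g i \in H i) ->
  (forall i, connect [rel E F in H i | weak_chain_step E F] (f i) (g i)) ->
  connect [rel E F in conj_compound H | chain_step E F]
    (\bigcup_i f i) (\bigcup_i g i).
Proof.
move=> p_gt1 H_neq0 fH gH fg.
pose mix (r : seq 'I_p) i := if i \in r then g i else f i.
have mixH r i : mix r i \in H i by rewrite /mix; case: ifP.
suff connect_mix r : connect [rel E F in conj_compound H | chain_step E F]
    (\bigcup_i f i) (\bigcup_i mix r i).
  have := connect_mix (enum 'I_p); congr connect; apply: eq_bigr => i _.
  by rewrite /mix mem_enum.
elim: r => [|i r IHr]; first exact: connect0.
apply: connect_trans IHr _.
have -> : \bigcup_j mix r j = \bigcup_j replace (mix r) i (mix r i) j.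
  apply: eq_bigr => j _; have [<-|neq_ij] := eqVneq i j.
    by rewrite replace_id.
  by rewrite replace_neq.
have -> : \bigcup_j mix (i :: r) j = \bigcup_j replace (mix r) i (g i) j.
  apply: eq_bigr => j _; have [<-|neq_ij] := eqVneq i j.
    by rewrite replace_id /mix mem_head.
  by rewrite replace_neq // /mix inE eq_sym (negPf neq_ij).
apply: (homo_connect (f := fun E => \bigcup_j replace (mix r) i E j)
  (e := [rel E F in H i | weak_chain_step E F])).
  move=> E F /andP[/andP[EH FH] EF]; apply: connect1.
  by rewrite /= !mem_compound ?chain_step_replace //; apply: mem_replace.
by rewrite {1}/mix; case: ifP => _; first apply: connect0.
Qed.

(** * Heights of the compound *)

Lemma move_compound x y :
  move (conj_compound H) x y <->
    (forall i, move (H i) (restrict (V i) x) (restrict (V i) y)) /\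
    {in ~: \bigcup_i V i, y =1 x}.
Proof.
split=> [/moveP[_ /compoundP[f fH ->]] | [xy eq_xy]].
  move/(edge_move_bigcup (edge_sub fH)) => [xy eq_xy]; split=> // i.
  by apply/moveP; exists (f i).
have /fin_all_exists2[f fH f_xy] i : exists2 E, E \in H i &
    edge_move E (restrict (V i) x) (restrict (V i) y) by apply/moveP.
apply/moveP; exists (\bigcup_i f i); first exact: mem_compound.
by apply/(edge_move_bigcup (edge_sub fH)).
Qed.

Lemma restrict_glue_move x z :
  (forall i, move (H i) (restrict (V i) x) (z i)) ->
  forall i, restrict (V i) (glue x z) = z i.
Proof.
move=> xz i; apply: restrict_glue.
exact: move_position (is_position_restrict x) (xz i).
Qed.

Lemma move_glue x z :
  (forall i, move (H i) (restrict (V i) x) (z i)) ->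
  move (conj_compound H) x (glue x z).
Proof.
move=> xz; apply/move_compound; split=> [i|]; last exact: glue_notin.
by rewrite restrict_glue_move.
Qed.

Lemma playable_compound x n :
  playable (conj_compound H) x n <->
  forall i, playable (H i) (restrict (V i) x) n.
Proof.
elim: n x => [|n IHn] x; first by split=> *; apply: playable0.
split=> [/playableS[y /move_compound[xy _] /IHn yn] i | xn].
  by apply/playableS; exists (restrict (V i) y).
have /fin_all_exists2[z xz zn] i : exists2 y,
    move (H i) (restrict (V i) x) y & playable (H i) y n by apply/playableS.
apply/playableS; exists (glue x z); first exact: move_glue.
by apply/IHn => i; rewrite restrict_glue_move.
Qed.

Lemma is_height_compound x (h : 'I_p -> nat) k :
  (forall i, is_height (H i) (restrict (V i) x) (h i)) ->
  (forall i, h k <= h i) -> is_height (conj_compound H) x (h k).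
Proof.
move=> hP h_min; apply/is_heightP => n.
have {}hP i : playable (H i) (restrict (V i) x) n <-> n <= h i.
  by have /is_heightP := hP i.
split=> [/playable_compound xn | le_n]; first exact/hP.
by apply/playable_compound => i; apply/hP; apply: leq_trans (h_min i).
Qed.

Lemma drops_height_compound x y : 0 < p ->
  (forall i, drops_height (H i) (restrict (V i) x) (restrict (V i) y)) ->
  drops_height (conj_compound H) x y.
Proof.
move=> p_gt0 /fin_all_exists2[h hx hy].
have [k _ h_min] := arg_minnP (i0 := Ordinal p_gt0) (P := predT) h isT.
exists (h k); last by apply: is_height_compound hy _ => i; apply: h_min.
by apply: (is_height_compound (h := fun i => (h i).+1)) => // i; apply: h_min.
Qed.

Lemma minimum_decreasing_compound : 0 < p -> (forall i, V i != set0) ->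
  (forall i, minimum_decreasing (V i) (H i)) ->
  minimum_decreasing (\bigcup_i V i) (conj_compound H).
Proof.
move=> p_gt0 V_neq0 md_H x _ x_gt0.
have x_gt0_in i : 0 < min_pos (V i) (restrict (V i) x).
  rewrite (eq_min_pos (@restrict_in _ (V i) x)); apply: leq_trans x_gt0 _.
  by rewrite min_pos_sub ?bigcup_sup.
have /fin_all_exists[z z_decr] i :=
  md_H i _ (is_position_restrict x) (x_gt0_in i).
have xz i : move (H i) (restrict (V i) x) (z i) by case: (z_decr i).
have zE := restrict_glue_move xz.
exists (glue x z); split; first exact: move_glue.
- by apply: min_pos_restrict_ltn => // i; rewrite zE; case: (z_decr i).
- by apply: drops_height_compound => // i; rewrite zE; case: (z_decr i).
move=> t /bigcupP[i _ tV].
rewrite -(restrict_in x tV) -(restrict_in (glue x z) tV) zE.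
by have [_ _ _] := z_decr i; apply.
Qed.

End DisjointCovers.

(** * Compounds of hypergraphs *)

Section Hypergraphs.

Variable H : 'I_p -> {set {set T}}.
Hypothesis hypH : forall i, is_hypergraph (V i) (H i).

Let cover_sub i : cover (H i) \subset V i.
Proof. by case: (hypH i) => _ _ ->. Qed.

Lemma edges_exist : exists f, forall i, f i \in H i.
Proof.
by have /fin_all_exists[f fH] i := edge_exists (hypH i); exists f.
Qed.

Lemma is_hypergraph_compound :
  0 < p -> is_hypergraph (\bigcup_i V i) (conj_compound H).
Proof.
move=> p_gt0; have [f fH] := edges_exist; pose i0 := Ordinal p_gt0.
have H_neq0 i : set0 \notin H i by case: (hypH i).
split.
- have [V_neq0 _ _] := hypH i0.
  by apply: subset_neq0 V_neq0; apply: bigcup_sup.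
- apply/compoundP => -[g gH /esym bigcup_g0].
  have := edge_neq0 (H_neq0 i0) (gH i0).
  by rewrite -subset0 -bigcup_g0 bigcup_sup.
apply/eqP; rewrite eqEsubset; apply/andP; split.
  apply/bigcupsP=> _ /compoundP[g gH ->]; apply: subset_bigcup => i.
  exact: subset_trans (bigcup_sup _ (gH i)) (cover_sub i).
apply/bigcupsP=> i _; have [_ _ <-] := hypH i; apply/bigcupsP=> E EH.
apply: subset_trans (bigcup_sup _ (mem_compound (mem_replace EH fH))).
by rewrite -{1}(replace_id f i E) bigcup_sup.
Qed.

Lemma minimal_transversal_free_compound :
  (forall i, minimal_transversal_free (V i) (H i)) ->
  minimal_transversal_free (\bigcup_i V i) (conj_compound H).
Proof.
move=> mtf_H; split=> [|S /properP[_ [t /bigcupP[i _ tV] tS]]].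
  by apply: (transversal_free_compound cover_sub) => i; case: (mtf_H i).
rewrite induced_compound => /set0Pn[_ /compoundP[f fHS _]].
have [E E_transversal] : exists E, transversal_edge (induced (H i) S) E.
  rewrite -(inducedIr S (cover_sub i)); apply: (mtf_H i).2.
    apply/properP; split; first exact: subsetIr.
    by exists t; rewrite // inE (negPf tS).
  by apply/set0Pn; exists (f i); rewrite inducedIr.
have [EHS _] := E_transversal; exists (\bigcup_j replace f i E j).
have cover_induced_sub j := subset_trans (cover_induced (H j) S) (cover_sub j).
apply/(transversal_compoundP cover_induced_sub); first exact: mem_replace.
by exists i; rewrite replace_id.
Qed.

Lemma chain_property_compound : 1 < p ->
  (forall i, step_connected (@weak_chain_step T) (H i)) ->
  chain_property (conj_compound H).
Proof.
move=> p_gt1 conn_H; apply/chain_propertyP.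
move=> _ _ /compoundP[f fH ->] /compoundP[g gH ->].
pose K i := induced (H i) (f i :|: g i).
have fK i : f i \in K i by rewrite mem_induced fH subsetUl.
have gK i : g i \in K i by rewrite mem_induced gH subsetUr.
have sub_K : {subset conj_compound K <=
    induced (conj_compound H) (\bigcup_i f i :|: \bigcup_i g i)}.
  by rewrite -big_split; apply/subsetP/compound_induced_sub.
have cover_K i : cover (K i) \subset V i.
  exact: subset_trans (cover_induced _ _) (cover_sub i).
have K_neq0 i : set0 \notin K i.
  have [_ H_neq0 _] := hypH i.
  by apply: contra H_neq0; apply/subsetP/induced_sub.
have fg_conn i : connect [rel E F in K i | weak_chain_step E F] (f i) (g i).
  exact: conn_H.
apply: connect_sub (connect_compound cover_K p_gt1 K_neq0 fK gK fg_conn).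
move=> E F /andP[/andP[/sub_K E_in /sub_K F_in] EF].
by apply/connect1/andP; split=> //; apply/andP.
Qed.

End Hypergraphs.
End Compound.

Lemma JM_plus_compound (T : finType) (p : nat) (V : 'I_p -> {set T})
    (H : 'I_p -> {set {set T}}) : 1 < p ->
  (forall i j : 'I_p, i != j -> [disjoint V i & V j]) ->
  (forall i, is_hypergraph (V i) (H i)) ->
  (forall i, weak_JM_plus (V i) (H i)) ->
  JM_plus (\bigcup_i V i) (conj_compound H).
Proof.
move=> p_gt1 disjV hypH weak_JM_H; split.
- by apply: minimal_transversal_free_compound => // i; case: (weak_JM_H i).
- have cover_sub i : cover (H i) \subset V i by case: (hypH i) => _ _ ->.
  have V_neq0 i : V i != set0 by case: (hypH i).
  apply: (minimum_decreasing_compound disjV cover_sub (ltnW p_gt1) V_neq0) => i.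
  by case: (weak_JM_H i).
by apply: chain_property_compound hypH _ _ => // i; case: (weak_JM_H i).
Qed.

Theorem theorem1 (T : finType) (p : nat) (V : 'I_p -> {set T})
    (H : 'I_p -> {set {set T}}) :
  2 <= p ->
  (forall i j : 'I_p, i != j -> [disjoint V i & V j]) ->
  (forall i : 'I_p, is_hypergraph (V i) (H i)) ->
  (forall i : 'I_p, JM_plus (V i) (H i) \/ two_singletons (V i) (H i)) ->
  is_hypergraph (\bigcup_i V i) (conj_compound H) /\
  JM_plus (\bigcup_i V i) (conj_compound H).
Proof.
move=> p_gt1 disjV hypH JM_H; split.
  by apply: is_hypergraph_compound => //; apply: ltnW.
apply: JM_plus_compound => // i.
by case: (JM_H i) => [/JM_plusW | /weak_JM_plus_two_singletons].
Qed.
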